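(* Let $G$ be a graph with $2r$ edges, where $r$ is the rank of the cycle matroid $M(G)$. Then the single exchange graph $\mathfrak{G}(M(G))$ is connected.
   Context: The cycle matroid $M(G)$ of a graph $G$ has ground set $E(G)$ and its bases are the spanning forests of $G$ (maximal acyclic edge subsets); its rank is $|V(G)|$ minus the number of connected components of $G$. For a matroid $M$ of rank $r$ on a ground set of size $2r$, the single exchange graph $\mathfrak{G}(M)$ is the graph whose vertices are the ordered pairs $(B_1,B_2)$ of disjoint bases of $M$, with an edge between $(B_1,B_2)$ and $(D_1,D_2)$ if and only if $|B_1\cap D_1|=r-1$ (equivalently, $(D_1,D_2)$ is obtained from $(B_1,B_2)$ by exchanging one element $b\in B_1$ with one element $d\in B_2$ so that both resulting sets are bases). *)

(* Defs.v *)
From mathcomp Require Import all_boot.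
Set Implicit Arguments. Unset Strict Implicit. Unset Printing Implicit Defensive.

(* A (multi)graph: finite vertex type V, finite edge type E, and an
   endpoint map; loops and parallel edges are allowed. *)
Section Graph.
Variables (V E : finType) (ends : E -> V * V).

Definition joins (e : E) (u v : V) : bool :=
  (ends e == (u, v)) || (ends e == (v, u)).

(* The edge set C is a cycle: there are distinct edges e_0..e_{k-1} (k>=1)
   and distinct vertices v_0..v_{k-1} with e_i joining v_i and v_{i+1 mod k}.
   (k = 1: a loop; k = 2: a pair of parallel edges.) *)
Definition is_cycle (C : {set E}) : Prop :=
  exists (es : seq E) (vs : seq V),
    [/\ 0 < size es, size es = size vs, uniq es & uniq vs] /\
    C = [set x in es] /\
        all (fun t => joins t.1 t.2.1 t.2.2) (zip es (zip vs (rot 1 vs))).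

Definition acyclic (F : {set E}) : Prop :=
  forall C, is_cycle C -> ~ (C \subset F).

Definition is_basis (B : {set E}) : Prop :=
  acyclic B /\ forall e, e \notin B -> ~ acyclic (e |: B).

Definition adjG : rel V := fun u v => [exists e, joins e u v].

Definition cycle_rank : nat := #|V| - n_comp adjG (mem predT).

Definition xvertex (p : {set E} * {set E}) : Prop :=
  [/\ is_basis p.1, is_basis p.2 & [disjoint p.1 & p.2]].

Definition xadj (p q : {set E} * {set E}) : Prop :=
  [/\ xvertex p, xvertex q & #|p.1 :&: q.1|.+1 = cycle_rank].

Definition exchange_graph_connected : Prop :=
  forall p q, xvertex p -> xvertex q ->
    exists s : seq ({set E} * {set E}),
      last p s = q /\
      forall i, i < size s -> xadj (nth p (p :: s) i) (nth p s i).

End Graph.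

(* Main.v *)
Require Import Defs.
From mathcomp Require Import all_boot.
Set Implicit Arguments. Unset Strict Implicit. Unset Printing Implicit Defensive.

(** Let [E] be the disjoint union of two bases; induct on the number of edges.
    Counting degrees gives a non-isolated vertex [v] of degree at most three, and
    both bases meet its star.  If [v] has degree two, each basis contains one of its
    edges, the two edges may always be exchanged, and [v] is deleted.  If [v] has
    edges [a], [b], [c], one of them is separated from the other two.  The pairs
    separating [c] from [a] and [b] correspond to the pairs of the graph in which
    [v] is deleted and [a], [b] are merged into one edge joining their far ends; an
    exchange there lifts to at most two exchanges, so these pairs are connected to
    each other.  From each of the three classes one exchange leads to another
    class, so the three classes are connected together.

    The cycle matroid is handled dually, through the binary code of cuts: [F] is
    independent iff each of its edges is the only edge of [F] in some cut, and [F]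
    spans [D] iff every cut that avoids [F] avoids [D]. *)

(** * Bases of a binary code *)

Section Code.
Variables (U E : finType) (d : U -> E -> bool).
Implicit Types (D F P Q X : {set E}) (u t : U).

Definition indep F :=
  [forall e in F, exists u, forall f in F, d u f == (f == e)].

Definition spans F D :=
  [forall u, [forall f in F, ~~ d u f] ==> [forall f in D, ~~ d u f]].

(** Bases are relative to an edge set [D], so that the induction can delete edges by shrinking [D]
    over a fixed type [E]. *)
Definition basis D F := [&& F \subset D, indep F & spans F D].

(** A pair of complementary bases of [D], stored as its first member. *)
Definition good D P := basis D P && basis D (D :\: P).

Definition swap D P Q :=
  [&& good D P, good D Q
    & [exists x in P, exists y in D :\: P, Q == y |: P :\ x]].

Lemma indepP F :
  reflect (forall e, e \in F -> exists u, forall f, f \in F -> d u f = (f == e))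
          (indep F).
Proof.
apply: (iffP forall_inP) => h e eF.
  have /existsP[u /forall_inP hu] := h e eF.
  by exists u => f fF; apply/eqP/hu.
have [u hu] := h e eF; apply/existsP; exists u.
by apply/forall_inP => f fF; rewrite hu.
Qed.

Lemma spansP F D :
  reflect (forall u, (forall f, f \in F -> d u f = false) ->
             forall f, f \in D -> d u f = false)
          (spans F D).
Proof.
apply: (iffP forallP) => h u.
  move=> hF f fD; have /implyP := h u.
  have -> : [forall f in F, ~~ d u f] by apply/forall_inP => g /hF ->.
  by move=> /(_ isT) /forall_inP /(_ _ fD) /negbTE.
apply/implyP => /forall_inP hF; apply/forall_inP => f fD.
by rewrite (h u) // => g /hF /negbTE.
Qed.

Lemma basisP D F :
  reflect [/\ F \subset D,
              forall e, e \in F -> exists u, forall f, f \in F -> d u f = (f == e)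
            & forall u, (forall f, f \in F -> d u f = false) ->
                forall f, f \in D -> d u f = false]
          (basis D F).
Proof.
apply: (iffP and3P) => [[h1 /indepP h2 /spansP h3]|[h1 h2 h3]]; split => //.
  exact/indepP.
exact/spansP.
Qed.

Lemma good_sub D P : good D P -> P \subset D.
Proof. by case/andP => /and3P[]. Qed.

Lemma goodC D P : P \subset D -> good D (D :\: P) = good D P.
Proof. by move=> sPD; rewrite /good setDDr setDv set0U (setIidPr sPD) andbC. Qed.

Lemma swap_sym D : symmetric (swap D).
Proof.
suff h P Q : swap D P Q -> swap D Q P by move=> P Q; apply/idP/idP; apply: h.
case/and3P => gP gQ /exists_inP[x xP /exists_inP[y]]; rewrite inE => /andP[yP yD].
move=> /eqP QE; apply/and3P; split => //.
apply/exists_inP; exists y; first by rewrite QE setU11.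
have xD : x \in D by apply: (subsetP (good_sub gP)).
have xy : x != y by apply: contraNneq yP => <-.
apply/exists_inP; exists x; first by rewrite QE !inE eqxx xD (negbTE xy).
apply/eqP/setP => z; rewrite QE !inE.
have [->|zx] := eqVneq z x; first by rewrite xP.
by have [->|//] := eqVneq z y; rewrite (negbTE yP).
Qed.

Lemma connect_swap_sym D : connect_sym (swap D).
Proof. by apply: sym_connect_sym; apply: swap_sym. Qed.

Lemma swap1 D P x y :
  good D P -> good D (y |: P :\ x) -> x \in P -> y \in D :\: P ->
  connect (swap D) P (y |: P :\ x).
Proof.
move=> gP gQ xP yP; apply: connect1; rewrite /swap gP gQ /=.
by apply/exists_inP; exists x => //; apply/exists_inP; exists y.
Qed.

(** Interchanging the two bases of every pair turns an exchange into an exchange. *)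
Lemma connect_swapC D P Q :
  connect (swap D) P Q -> connect (swap D) (D :\: P) (D :\: Q).
Proof.
case/connectP => s; elim: s P => [|R s IHs] P /=; first by move=> _ ->.
case/andP => /and3P[gP gR hx] /IHs hs /hs; apply: connect_trans.
case/exists_inP: hx => x xP /exists_inP[y]; rewrite inE => /andP[yP yD] /eqP RE.
have xD : x \in D by apply: (subsetP (good_sub gP)).
have := gR; rewrite -goodC ?(good_sub gR) //.
have -> : D :\: R = x |: (D :\: P) :\ y.
  apply/setP => z; rewrite RE !inE.
  have [->|zx] := eqVneq z x; first by rewrite xD andbT orbF; apply: contraNneq yP => <-.
  by have [->|] := eqVneq z y.
move=> gR'; apply: swap1; rewrite ?goodC ?(good_sub gP) //.
  by rewrite inE yP.
by rewrite !inE xP xD.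
Qed.

End Code.

Lemma connect_homo (S T : finType) (e : rel S) (e' : rel T) (f : S -> T) :
  (forall x y, e x y -> connect e' (f x) (f y)) ->
  forall x y, connect e x y -> connect e' (f x) (f y).
Proof.
move=> h x y /connectP[s]; elim: s x => [|z s IHs] x /=; first by move=> _ ->.
by case/andP => /h xz /IHs hs /hs; apply: connect_trans.
Qed.

(** * Vertices of degree two and three *)

Section Additive.
Variables (U E : finType) (d : U -> E -> bool).
Hypothesis dD : forall s t, exists u, forall e, d u e = d s e (+) d t e.
Implicit Types (D F P Q X : {set E}) (u t : U).

(** Here [u] is the fundamental cut of [a] in [F]. A witness of independence that contains [c] is
    corrected by adding [u]. A word avoiding the new set but containing [a] would, after adding [u],
    avoid [F] and still contain [c]. *)
Lemma basis_exchange D F a c u :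
  basis d D F -> a \in F -> c \in D -> (forall f, f \in F -> d u f = (f == a)) ->
  d u c -> basis d D (c |: F :\ a).
Proof.
case/basisP => sFD iF spF aF cD hu uc.
apply/basisP; split.
- by rewrite subUset sub1set cD (subset_trans (subD1set _ _)).
- move=> e; rewrite !inE => /orP[/eqP->|/andP[ea eF]].
    exists u => f; rewrite !inE => /orP[/eqP->|/andP[fa fF]].
      by rewrite uc eqxx.
    rewrite hu // (negbTE fa); apply/esym/eqP => fc.
    by move: uc; rewrite -fc hu // (negbTE fa).
  have [w hw] := iF e eF.
  have [w' [w'F w'c]] : exists w', (forall f, f \in F :\ a -> d w' f = (f == e))
      /\ d w' c = false.
    case wc: (d w c); last by exists w; split=> // f; rewrite !inE => /andP[_ /hw].
    have [w' hw'] := dD w u; exists w'; split; last by rewrite hw' wc uc.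
    move=> f; rewrite !inE => /andP[fa fF].
    by rewrite hw' hw // hu // (negbTE fa) addbF.
  exists w' => f; rewrite !inE => /orP[/eqP->|fF]; last by apply: w'F; rewrite !inE.
  rewrite w'c; apply/esym/eqP => ce.
  by move: uc; rewrite ce hu // (negbTE ea).
- move=> w hw; have wc : d w c = false by apply: hw; rewrite setU11.
  have wF f : f \in F -> f != a -> d w f = false.
    by move=> fF fa; apply: hw; rewrite !inE fa fF orbT.
  apply: (spF) => f fF; have [->|] := eqVneq f a; last exact: wF.
  apply/negbTE/negP => wa; have [w' hw'] := dD w u.
  suff : d w' c = false by rewrite hw' wc uc.
  apply: spF cD => g gF; rewrite hw' hu //.
  by have [->|ga] := eqVneq g a; rewrite ?wa // wF.
Qed.

(* [t] is the cut separating a vertex from the rest, [K] the set of its edges. *)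
Section Star.
Variables (D0 K : {set E}) (t : U).
Hypotheses (KD0 : [disjoint K & D0]) (tK : forall e, e \in K -> d t e = true).
Hypothesis (tD0 : forall e, e \in D0 -> d t e = false).

(** Adding [t], that is, moving the vertex across the cut, complements a word on [K] and keeps it on
    [D0]. Hence a word can be made zero at any chosen star edge. *)
Lemma star_shift u z : exists w,
  (forall e, e \in D0 -> d w e = d u e) /\ (forall e, e \in K -> d w e = d u e (+) z).
Proof.
case: z; last by exists u; split => // e _; rewrite addbF.
have [w hw] := dD u t; exists w; split => e eX; rewrite hw.
  by rewrite tD0 // addbF.
by rewrite tK.
Qed.

Lemma basis_meets_star F : basis d (K :|: D0) F -> K != set0 ->
  exists2 a, a \in K & a \in F.
Proof.
case/basisP => sF _ spF /set0Pn[k kK].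
have /existsP[a /andP[]] : [exists a, (a \in K) && (a \in F)]; last by exists a.
apply: contraT; rewrite negb_exists => /forallP h.
suff : d t k = false by rewrite tK.
apply: spF; last by rewrite inE kK.
move=> f fF; have := h f; rewrite fF andbT => fK; apply: tD0.
by have := subsetP sF _ fF; rewrite inE (negbTE fK).
Qed.

(** In a graph this says that the far ends of the star lie in one component of [D0]. *)
Definition star_const := forall u,
  (forall f, f \in D0 -> d u f = false) -> {in K &, forall e f, d u e = d u f}.

(** A word that vanishes on [D0] can be shifted to vanish at [a] too; it then avoids the basis,
    hence all of [K]. *)
Lemma basis_star_const X a : X \subset D0 -> a \in K -> basis d (K :|: D0) (a |: X) ->
  star_const.
Proof.
move=> sX aK /basisP[sFD _ spF] u hu.
have [w [wD0 wK]] := star_shift u (d u a).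
suff u0 e : e \in K -> d u e = d u a by move=> e f eK fK; rewrite !u0.
move=> eK; suff : d w e = false by rewrite wK //; case: (d u e); case: (d u a).
apply: spF; last by rewrite inE eK.
move=> f; rewrite !inE => /orP[/eqP->|fX]; first by rewrite wK // addbb.
by rewrite wD0 ?hu // (subsetP sX).
Qed.

Lemma star_notin e : e \in K -> e \notin D0.
Proof. by move=> eK; rewrite (disjointFr KD0). Qed.

Lemma star_neq e f : e \in K -> f \in D0 -> (e == f = false) * (f == e = false).
Proof.
move=> /star_notin eK fD; suff h : e == f = false by rewrite h eq_sym h.
by apply: contraNF eK => /eqP->.
Qed.

(** The vertex is a leaf hanging on [a]. Words are shifted to vanish at [a], [t] isolates [a], and
    [star_const] makes the other star edges spanned. *)
Lemma basis_star1 X a : star_const -> X \subset D0 -> a \in K ->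
  basis d (K :|: D0) (a |: X) = basis d D0 X.
Proof.
move=> cK sX aK; have XD0 := subsetP sX; apply/basisP/basisP.
  case=> _ iF spF; split => //.
    move=> e eX; have [u hu] := iF e (setU1r _ eX).
    by exists u => f fX; apply: hu; apply: setU1r.
  move=> u hu f fD0; have [w [wD0 wK]] := star_shift u (d u a).
  rewrite -wD0 //; apply: spF; last by rewrite inE fD0 orbT.
  move=> g; rewrite !inE => /orP[/eqP->|gX]; first by rewrite wK // addbb.
  by rewrite wD0 ?hu ?XD0.
case=> _ iX spX; split.
- by rewrite subUset sub1set inE aK /= (subset_trans sX) // subsetUr.
- move=> e; rewrite !inE => /orP[/eqP->|eX].
    exists t => f; rewrite !inE => /orP[/eqP->|fX]; first by rewrite tK // eqxx.
    by rewrite tD0 ?XD0 // (star_neq aK) ?XD0.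
  have [u hu] := iX e eX; have [w [wD0 wK]] := star_shift u (d u a).
  exists w => f; rewrite !inE => /orP[/eqP->|fX].
    by rewrite wK // addbb (star_neq aK) ?XD0.
  by rewrite wD0 ?XD0 ?hu.
move=> u hu.
have uD0 f : f \in D0 -> d u f = false.
  by apply: spX => g gX; apply: hu; apply: setU1r.
move=> f; rewrite inE => /orP[fK|/uD0//].
by rewrite (cK u uD0 f a) // hu // setU11.
Qed.

(** Of at most three star edges, one of the two bases holds at most one, hence exactly one. *)
Lemma good_star_const P : good d (K :|: D0) P -> 0 < #|K| <= 3 -> star_const.
Proof.
move=> gP /andP[K0 K3]; have /andP[bP bQ] := gP.
have {}K0 : K != set0 by rewrite -card_gt0.
have main F : basis d (K :|: D0) F -> #|K :&: F| <= 1 -> star_const.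
  move=> bF KF1; have [a aK aF] := basis_meets_star bF K0.
  have KFE : K :&: F = [set a].
    by apply/esym/eqP; rewrite eqEcard cards1 KF1 andbT sub1set inE aK.
  apply: (@basis_star_const (F :&: D0) a) => //; first exact: subsetIr.
  have <- // : F = a |: F :&: D0; apply/setP => e; rewrite !inE.
  have [->|ea] := eqVneq e a; first by [].
  case eF: (e \in F) => //=; have /basisP[sF _ _] := bF.
  have := subsetP sF e eF; rewrite inE => /orP[eK|->//].
  have : e \in K :&: F by rewrite inE eK.
  by rewrite KFE inE (negbTE ea).
have [|h] := leqP #|K :&: P| 1; first exact: main.
apply: main bQ _; have -> : K :&: ((K :|: D0) :\: P) = K :\: P.
  by apply/setP => e; rewrite !inE; case: (e \in K); rewrite ?andbT ?andbF.
by rewrite -(leq_add2l 2); apply: leq_trans K3; rewrite -(cardsID P K) leq_add2r.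
Qed.

End Star.

Lemma connect_star2 D0 a b t P Q : let K := [set a; b] in let D := K :|: D0 in
  a != b -> [disjoint K & D0] ->
  (forall e, e \in K -> d t e = true) -> (forall e, e \in D0 -> d t e = false) ->
  (forall P Q, good d D0 P -> good d D0 Q -> connect (swap d D0) P Q) ->
  good d D P -> good d D Q -> connect (swap d D) P Q.
Proof.
move=> K D ab KD0 tK tD0 IH gP gQ.
have aK : a \in K by rewrite !inE eqxx.
have bK : b \in K by rewrite !inE eqxx orbT.
have K0 : K != set0 by apply/set0Pn; exists a.
have nD0 := star_notin KD0.
have cK : star_const D0 K.
  by apply: (good_star_const tK tD0 gP); rewrite cards2 ab.
(* The two star edges fall into different bases, each as a leaf edge over a basis of [D0]. *)
have good2 X x : X \subset D0 -> x \in K -> good d D (x |: X) = good d D0 X.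
  move=> sX xK; rewrite /good (basis_star1 KD0 tK tD0) //.
  have [y yK ->] : exists2 y, y \in K & D :\: (x |: X) = y |: (D0 :\: X).
    have aX : a \in X = false by rewrite (contraNF (subsetP sX a)) ?nD0.
    have bX : b \in X = false by rewrite (contraNF (subsetP sX b)) ?nD0.
    move: xK; rewrite !inE => /orP[]/eqP->; [exists b => // | exists a => //];
      apply/setP => e; rewrite !inE.
      have [->|ea] := eqVneq e a; first by rewrite (negbTE ab) (negbTE (nD0 _ aK)) andbF.
      by have [->|//] := eqVneq e b; rewrite bX.
    have [->|ea] := eqVneq e a; first by rewrite (negbTE ab) aX.
    by have [->|//] := eqVneq e b; rewrite (negbTE (nD0 _ bK)) andbF.
  by rewrite (basis_star1 KD0 tK tD0) // subDset subsetUr.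
(* At most one exchange of [a] and [b] brings [a] into the first basis. *)
have norm R : good d D R ->
    exists X, [/\ X \subset D0, good d D0 X & connect (swap d D) R (a |: X)].
  move=> gR; have /andP[bR bR'] := gR.
  have [x xK xR] := basis_meets_star tK tD0 bR K0.
  have [y yK] := basis_meets_star tK tD0 bR' K0; rewrite inE => /andP[yR yD].
  have sX : R :&: D0 \subset D0 := subsetIr _ _.
  have RE : R = x |: R :&: D0.
    apply/setP => e; rewrite !inE; have [->|ex] := eqVneq e x; first by [].
    case eR: (e \in R) => //=; have := subsetP (good_sub gR) e eR.
    rewrite inE => /orP[eK|->//]; move: eR yR xR ex.
    by move: xK yK eK; rewrite !inE => /orP[]/eqP-> /orP[]/eqP-> /orP[]/eqP->
      eR /negP yR xR /eqP.
  have gX : good d D0 (R :&: D0) by rewrite -(good2 _ x) // -RE.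
  exists (R :&: D0); split => //.
  have [xa|xa] := eqVneq x a; first by rewrite {1}RE xa.
  have aR : a \notin R.
    rewrite RE !inE eq_sym (negbTE xa) (negbTE (nD0 _ aK)) andbF //.
  have E1 : a |: R :&: D0 = a |: R :\ x.
    apply/setP => e; rewrite [in RHS]RE !inE; have [->|ex] := eqVneq e x.
      by rewrite (negbTE (nD0 _ xK)) andbF.
    by [].
  rewrite E1; apply: swap1; rewrite -?E1 ?good2 //.
  by rewrite inE aR inE aK.
have [X [sX gX hP]] := norm P gP; have [Y [sY gY hQ]] := norm Q gQ.
apply: connect_trans hP _; rewrite connect_swap_sym; apply: connect_trans hQ _.
(* With [a] held in the first basis, every exchange in [D0] is an exchange in [D]. *)
rewrite connect_swap_sym; apply: connect_homo (IH _ _ gX gY) => {gX gY sX sY}{}X {}Y.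
case/and3P => gX gY /exists_inP[x xX /exists_inP[y]].
rewrite inE => /andP[yX yD0] /eqP YE.
have xD0 := subsetP (good_sub gX) x xX.
have E1 : a |: Y = y |: (a |: X) :\ x.
  rewrite YE; apply/setP => e; rewrite !inE.
  by have [->|//] := eqVneq e a; rewrite (star_neq KD0 aK xD0) orbT.
rewrite E1; apply: swap1; rewrite -?E1 ?good2 ?(good_sub gX) ?(good_sub gY) //.
  by rewrite setU1r.
by rewrite !inE (star_neq KD0 aK yD0) (negbTE yX) yD0 orbT.
Qed.

(** The witnesses of the elements of [G] are added up, starting from the zero word, which is [u0]
    plus itself. *)
Lemma indep_cut (u0 : U) (F G : {set E}) : indep d F -> G \subset F ->
  exists u, forall f, f \in F -> d u f = (f \in G).
Proof.
move=> /indepP iF; have [n] := ubnP #|G|; elim: n G => // n IHn G.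
have [->|/set0Pn[g gG]] := eqVneq G set0.
  by have [u hu] := dD u0 u0; exists u => f _; rewrite hu addbb inE.
rewrite (cardsD1 g) gG => /IHn IH sGF.
have [u hu] := IH (subset_trans (subD1set _ _) sGF).
have [w hw] := iF g (subsetP sGF g gG).
have [v hv] := dD u w; exists v => f fF; rewrite hv hu // hw // !inE.
by have [->|] := eqVneq f g; rewrite ?gG ?addbF.
Qed.

(* Splitting off the pair [a], [b] at a vertex of degree three: in the new code [d'] the
   edge [a] joins the far ends of [a] and [b]. *)
Section Split.
Variables (D0 : {set E}) (a b c : E) (t : U) (d' : U -> E -> bool).
Let K := a |: (b |: [set c]).
Hypotheses (ab : a != b) (ac : a != c) (bc : b != c).
Hypotheses (KD0 : [disjoint K & D0]) (tK : forall e, e \in K -> d t e = true).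
Hypothesis (tD0 : forall e, e \in D0 -> d t e = false).
Hypothesis (d'D0 : forall u e, e \in D0 -> d' u e = d u e).
Hypothesis (d'a : forall u, d' u a = d u a (+) d u b).
Hypothesis cK : star_const D0 K.
Let D := K :|: D0.
Let D' := a |: D0.

Let aK : a \in K. Proof. by rewrite !inE eqxx. Qed.
Let bK : b \in K. Proof. by rewrite !inE eqxx orbT. Qed.
Let cK' : c \in K. Proof. by rewrite !inE eqxx !orbT. Qed.
Let neqD0 := star_neq KD0.
Let aD0 := star_notin KD0 aK.
Let bD0 := star_notin KD0 bK.
Let cD0 := star_notin KD0 cK'.

(** The edge [c] is a leaf edge over a basis of [D0], and by [star_const] the merged edge is already
    spanned by [D0]. *)
Lemma basis_split1 X : X \subset D0 -> basis d D (c |: X) = basis d' D' X.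
Proof.
move=> sX; have XD0 := subsetP sX.
rewrite (basis_star1 KD0 tK tD0) //; apply/basisP/basisP => -[_ iX spX]; split => //.
- by rewrite (subset_trans sX) // subsetUr.
- move=> e /iX[u hu]; exists u => f fX; rewrite d'D0 ?XD0 ?hu //.
- move=> u hu.
  have uD0 f : f \in D0 -> d u f = false.
    by apply: spX => g gX; rewrite -d'D0 ?XD0 ?hu.
  move=> f; rewrite !inE => /orP[/eqP->|fD0]; last by rewrite d'D0 ?uD0.
  by rewrite d'a (cK uD0 aK bK) addbb.
- by move=> e /iX[u hu]; exists u => f fX; rewrite -d'D0 ?XD0 ?hu.
- move=> u hu f fD0; rewrite -d'D0 //; apply: spX; last exact: setU1r.
  by move=> g gX; rewrite d'D0 ?XD0 ?hu.
Qed.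

(** The path formed by [a] and [b] subdivides the merged edge. Once a word is shifted to vanish on
    one of the two, the other carries the value of the merged edge. *)
Lemma basis_split2 X : X \subset D0 ->
  basis d D (a |: (b |: X)) = basis d' D' (a |: X).
Proof.
move=> sX; have XD0 := subsetP sX; have ba : b == a = false by rewrite eq_sym (negbTE ab).
apply/basisP/basisP => -[_ iX spX]; split.
- exact: setUS.
- move=> e; rewrite !inE => /orP[/eqP->|eX].
    have [u hu] := iX a (setU11 _ _); exists u => f; rewrite !inE => /orP[/eqP->|fX].
      by rewrite d'a !hu ?inE ?eqxx ?orbT // ba.
    by rewrite d'D0 ?XD0 // hu ?inE ?fX ?orbT.
  have [|u hu] := iX e; first by rewrite !inE eX !orbT.
  exists u => f; rewrite !inE => /orP[/eqP->|fX].
    by rewrite d'a !hu ?inE ?eqxx ?orbT // !neqD0 ?XD0.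
  by rewrite d'D0 ?XD0 // hu ?inE ?fX ?orbT.
- move=> u hu; have uab : d u a = d u b.
    by have := hu a (setU11 _ _); rewrite d'a; case: (d u a); case: (d u b).
  have [w [wD0 wK]] := star_shift tK tD0 u (d u a).
  have uD0 f : f \in D0 -> d u f = false.
    move=> fD0; rewrite -wD0 //; apply: spX; last by rewrite inE fD0 orbT.
    move=> g; rewrite !inE => /or3P[/eqP->|/eqP->|gX].
    + by rewrite wK // addbb.
    + by rewrite wK // uab addbb.
    + by rewrite wD0 ?XD0 // -d'D0 ?XD0 // hu // setU1r.
  move=> f; rewrite !inE => /orP[/eqP->|fD0]; last by rewrite d'D0 ?uD0.
  by rewrite d'a uab addbb.
- rewrite !subUset !sub1set !inE !eqxx !orbT /=.
  by rewrite (subset_trans sX) // subsetUr.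
- have lift e g u : g \in K -> (forall f, f \in a |: X -> d' u f = (f == e)) ->
      exists2 w, (forall f, f \in X -> d w f = (f == e)) &
        (d w g = false /\ d w a (+) d w b = (a == e)).
    move=> gK hu; have [w [wD0 wK]] := star_shift tK tD0 u (d u g).
    exists w; first by move=> f fX; rewrite wD0 ?XD0 // -d'D0 ?XD0 // hu // setU1r.
    split; first by rewrite wK // addbb.
    rewrite !wK // addbACA addbb addbF -d'a hu ?setU11 //.
  move=> e; rewrite !inE => /or3P[/eqP->|/eqP->|eX].
  + have [u /(lift _ _ _ bK)[w wX [wb]]] := iX a (setU11 _ _).
    rewrite wb addbF eqxx => wa; exists w => f.
    by rewrite !inE => /or3P[/eqP->|/eqP->|/wX//]; rewrite ?wa ?wb ?eqxx ?ba.
  + have [u /(lift _ _ _ aK)[w wX [wa]]] := iX a (setU11 _ _).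
    rewrite wa addFb eqxx => wb; exists w => f.
    rewrite !inE => /or3P[/eqP->|/eqP->|fX]; rewrite ?wa ?wb ?eqxx ?(negbTE ab) //.
    by rewrite wX // (neqD0 aK) ?XD0 // (neqD0 bK) ?XD0.
  + have [u /(lift _ _ _ aK)[w wX [wa]]] := iX e (setU1r _ eX).
    rewrite wa addFb !neqD0 ?XD0 // => wb; exists w => f.
    by rewrite !inE => /or3P[/eqP->|/eqP->|/wX//]; rewrite ?wa ?wb !neqD0 ?XD0.
- move=> u hu.
  have uab : d u a = false /\ d u b = false by rewrite !hu ?inE ?eqxx ?orbT.
  have uD0 f : f \in D0 -> d u f = false.
    move=> fD0; rewrite -d'D0 //; apply: spX; last exact: setU1r.
    move=> g; rewrite !inE => /orP[/eqP->|gX]; first by rewrite d'a uab.1 uab.2.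
    by rewrite d'D0 ?XD0 // hu // !inE gX !orbT.
  move=> f; rewrite inE => /orP[fK|/uD0//].
  by rewrite (cK uD0 fK aK) uab.1.
Qed.

Lemma good_split1 X : X \subset D0 -> good d D (c |: X) = good d' D' X.
Proof.
move=> sX; have XD0 := subsetP sX; rewrite /good basis_split1 //.
have -> : D :\: (c |: X) = a |: (b |: (D0 :\: X)).
  apply/setP => e; rewrite !inE.
  have [->|ea] := eqVneq e a; first by rewrite (negbTE ac) (contraNF (XD0 a)).
  have [->|eb] := eqVneq e b; first by rewrite (negbTE bc) (contraNF (XD0 b)).
  by have [->|] := eqVneq e c; rewrite //= (negbTE cD0) andbF.
have -> : D' :\: X = a |: (D0 :\: X).
  apply/setP => e; rewrite !inE.
  by have [->|ea] := eqVneq e a; first by rewrite (contraNF (XD0 a)).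
by rewrite basis_split2 // subDset subsetUr.
Qed.

Lemma good_split2 X : X \subset D0 -> good d D (a |: (b |: X)) = good d' D' (a |: X).
Proof.
move=> sX; have XD0 := subsetP sX; rewrite /good basis_split2 //.
have -> : D :\: (a |: (b |: X)) = c |: (D0 :\: X).
  apply/setP => e; rewrite !inE.
  have [->|ea] := eqVneq e a; first by rewrite (negbTE ac) (negbTE aD0) andbF.
  have [->|eb] := eqVneq e b; first by rewrite (negbTE bc) (negbTE bD0) andbF.
  by have [->|] := eqVneq e c; rewrite //= (contraNF (XD0 c)).
have -> : D' :\: (a |: X) = D0 :\: X.
  apply/setP => e; rewrite !inE.
  by have [->|ea] := eqVneq e a; first by rewrite (negbTE aD0) andbF.
by rewrite basis_split1 // subDset subsetUr.
Qed.

Let cN :=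
  (negbTE ab, negbTE ac, negbTE bc, negbTE aD0, negbTE bD0, negbTE cD0).
Let cNs : (b == a = false) * (c == a = false) * (c == b = false).
Proof. by rewrite ![_ == a]eq_sym [c == b]eq_sym !cN. Qed.

(** If [u] and [w] are the fundamental cuts of [a] and [b], the sum of [u], [w] and [t] avoids the
    basis, hence avoids [c]. So exactly one of [u] and [w] contains [c], and its edge can be
    replaced by [c]. *)
Lemma basis_rotate X : X \subset D0 -> basis d D (a |: (b |: X)) ->
  basis d D (a |: (c |: X)) \/ basis d D (b |: (c |: X)).
Proof.
move=> sX bF; have [_ iF spF] := basisP _ _ _ bF; have XD0 := subsetP sX.
have [|u hu] := iF a; first by rewrite !inE eqxx.
have [|w hw] := iF b; first by rewrite !inE eqxx orbT.
have cD : c \in D by rewrite !inE eqxx !orbT.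
have cu : d u c (+) d w c.
  have [v hv] := dD u w; have [v' hv'] := dD v t.
  have : d v' c = false; last by rewrite hv' hv tK // addbT => /negbFE.
  apply: spF cD => f fF; rewrite hv' hv hu // hw //.
  move: fF; rewrite !inE => /or3P[/eqP->|/eqP->|/XD0 fD0].
  - by rewrite eqxx !cN tK.
  - by rewrite eqxx !cNs tK.
  - by rewrite (neqD0 aK) // (neqD0 bK) // tD0.
case uc: (d u c) cu => /= cu; [right | left].
  have := basis_exchange bF _ cD hu uc; rewrite !inE eqxx => /(_ isT).
  congr (basis _ _ _); apply/setP => e; rewrite !inE.
  have [->|ea] := eqVneq e a; last by rewrite /= orbCA.
  by rewrite !cN (contraNF (XD0 a)).
have := basis_exchange bF _ cD hw cu; rewrite !inE eqxx orbT => /(_ isT).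
congr (basis _ _ _); apply/setP => e; rewrite !inE.
have [->|eb] := eqVneq e b; last by rewrite /= orbCA.
by rewrite !cN !cNs (contraNF (XD0 b)).
Qed.

Lemma good_rotate X : X \subset D0 -> good d D (a |: (b |: X)) ->
  exists2 x, (x == a) || (x == b) &
    good d D (x |: (c |: X)) /\ connect (swap d D) (a |: (b |: X)) (x |: (c |: X)).
Proof.
move=> sX gP; have XD0 := subsetP sX; have /andP[bP bQ] := gP.
have hX x : x \in K -> x \in X = false by move=> xK; rewrite (contraNF (XD0 x)) // (star_notin KD0).
have sY : D0 :\: X \subset D0 by rewrite subDset subsetUr.
have QE : D :\: (a |: (b |: X)) = c |: (D0 :\: X).
  apply/setP => e; rewrite !inE.
  have [->|ea] := eqVneq e a; first by rewrite !cN andbF.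
  have [->|eb] := eqVneq e b; first by rewrite !cN andbF.
  by have [->|] := eqVneq e c; rewrite //= hX.
(* The second basis has [c] as its only star edge, so any other star edge may replace it; only the
   first basis restricts the exchange. *)
have b0 : basis d D0 (D0 :\: X).
  by rewrite -(basis_star1 KD0 tK tD0 cK sY cK') -QE.
have [bx|bx] := basis_rotate sX bP.
  have gQ : good d D (a |: (c |: X)).
    rewrite /good bx; have -> : D :\: (a |: (c |: X)) = b |: (D0 :\: X).
      apply/setP => e; rewrite !inE.
      have [->|ea] := eqVneq e a; first by rewrite !cN andbF.
      have [->|eb] := eqVneq e b; first by rewrite !cN hX.
      by have [->|] := eqVneq e c; rewrite //= !cN andbF.
    by rewrite (basis_star1 KD0 tK tD0).
  exists a; rewrite ?eqxx //; split => //.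
  have E1 : a |: (c |: X) = c |: (a |: (b |: X)) :\ b.
    apply/setP => e; rewrite !inE.
    have [->|ea] := eqVneq e a; first by rewrite !cN orbT.
    have [->|eb] := eqVneq e b; first by rewrite !cN hX.
    by [].
  rewrite E1; apply: swap1; rewrite -?E1 //; rewrite !inE ?eqxx ?orbT //.
  by rewrite !cNs hX.
have gQ : good d D (b |: (c |: X)).
  rewrite /good bx; have -> : D :\: (b |: (c |: X)) = a |: (D0 :\: X).
    apply/setP => e; rewrite !inE.
    have [->|ea] := eqVneq e a; first by rewrite !cN hX.
    have [->|eb] := eqVneq e b; first by rewrite !cN andbF.
    by have [->|] := eqVneq e c; rewrite //= !cN andbF.
  by rewrite (basis_star1 KD0 tK tD0).
exists b; rewrite ?eqxx ?orbT //; split => //.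
have E1 : b |: (c |: X) = c |: (a |: (b |: X)) :\ a.
  apply/setP => e; rewrite !inE.
  have [->|ea] := eqVneq e a; first by rewrite !cN hX.
  by rewrite /= orbCA.
rewrite E1; apply: swap1; rewrite -?E1 //; rewrite !inE ?eqxx ?orbT //.
by rewrite !cNs hX.
Qed.

(** If the merged edge lies in [P], it becomes the path [a], [b] and [c] goes to the other basis;
    otherwise that path lies in the other basis and [c] joins [P]. *)
Definition unsplit P := if a \in P then b |: P else c |: P.

Lemma good_unsplit P : P \subset D' -> good d D (unsplit P) = good d' D' P.
Proof.
move=> sP; rewrite /unsplit; case: ifPn => aP.
  have sX : P :\ a \subset D0 by rewrite subDset.
  by rewrite -{2}(setD1K aP) -good_split2 // setUCA setD1K.
rewrite good_split1 //; apply/subsetP => e eP.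
by have /setU1P[ea|//] := subsetP sP e eP; rewrite -ea eP in aP.
Qed.

(** Trading the merged edge for [y] lifts to two exchanges: first one of [a], [b] is traded for [y],
    then the remaining one, [z], for [c]. *)
Lemma connect_split_vertex X y : X \subset D0 -> y \in D0 :\: X ->
  good d' D' (a |: X) -> good d' D' (y |: X) ->
  connect (swap d D) (a |: (b |: X)) (c |: (y |: X)).
Proof.
move=> sX; rewrite inE => /andP[yX yD0] gP' gQ'.
have XD0 := subsetP sX.
have hX x : x \in K -> x \in X = false by move=> xK; rewrite (contraNF (XD0 x)) // (star_notin KD0).
have hy x : x \in K -> (x == y = false) * (y == x = false) by move=> xK; apply: neqD0.
have sX' : y |: X \subset D0 by rewrite subUset sub1set yD0.
have gP : good d D (a |: (b |: X)) by rewrite good_split2.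
have gQ : good d D (c |: (y |: X)) by rewrite good_split1.
have sY : D0 :\: (y |: X) \subset D0 by rewrite subDset subsetUr.
have b0 : basis d D0 (y |: X).
  by rewrite -(basis_star1 KD0 tK tD0 cK sX' cK'); case/andP: gQ.
have bY : basis d D (a |: (b |: (D0 :\: (y |: X)))).
  rewrite basis_split2 //; case/andP: gQ' => _; congr (basis _ _ _).
  apply/setP => e; rewrite !inE; have [->|//] := eqVneq e a.
  by rewrite hX // hy.
have hM z : (z == a) || (z == b) -> basis d D (D :\: (z |: (y |: X))) ->
    connect (swap d D) (a |: (b |: X)) (c |: (y |: X)).
  move=> zab bM; have zK : z \in K by case/orP: zab => /eqP->.
  have gM : good d D (z |: (y |: X)) by rewrite /good (basis_star1 KD0 tK tD0) // b0.
  apply: (@connect_trans _ _ (z |: (y |: X))).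
    have [w [wab wz]] : exists w, w \in [set a; b] /\ z |: (y |: X) = y |: (a |: (b |: X)) :\ w.
      case/orP: zab => /eqP ->; [exists b | exists a]; split; rewrite ?inE ?eqxx ?orbT //.
        apply/setP => e; rewrite !inE.
        have [->|eb] := eqVneq e b; first by rewrite !cNs hX // hy.
        by rewrite /= orbCA.
      apply/setP => e; rewrite !inE.
      have [->|ea] := eqVneq e a; first by rewrite !cN hX // hy.
      by rewrite /= orbCA.
    rewrite wz; apply: swap1; rewrite -?wz //.
      by move: wab; rewrite !inE orbA => ->.
    by rewrite !inE !hy // yD0 orbT (negbTE yX).
  have E1 : c |: (y |: X) = c |: (z |: (y |: X)) :\ z.
    apply/setP => e; rewrite !inE.
    by have [->|//] := eqVneq e z; rewrite hX // hy.
  rewrite E1; apply: swap1; rewrite -?E1 ?setU11 //.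
  rewrite !inE eqxx !orbT andbT hX // hy // !orbF.
  by case/orP: zab => /eqP->; rewrite cNs.
(* The second basis of the target contains [a] and [b]; rotating it decides which of them is the
   intermediate [z]. *)
have [bM|bM] := basis_rotate sY bY; [apply: (hM b) | apply: (hM a)]; rewrite ?eqxx ?orbT //.
  move: bM; congr (basis _ _ _); apply/setP => e; rewrite !inE.
  have [->|ea] := eqVneq e a; first by rewrite !cN hX // hy.
  have [->|eb] := eqVneq e b; first by rewrite !cN andbF.
  by have [->|] := eqVneq e c; rewrite //= hX // hy.
move: bM; congr (basis _ _ _); apply/setP => e; rewrite !inE.
have [->|ea] := eqVneq e a; first by rewrite !cN andbF.
have [->|eb] := eqVneq e b; first by rewrite hX // hy.
by have [->|] := eqVneq e c; rewrite //= hX // hy.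
Qed.

(** An exchange that moves the merged edge takes two steps, and any other exchange lifts to one. *)
Lemma connect_unsplit P Q : swap d' D' P Q ->
  connect (swap d D) (unsplit P) (unsplit Q).
Proof.
have main R y : good d' D' R -> a \in R -> y \in D' :\: R -> good d' D' (y |: R :\ a) ->
    connect (swap d D) (unsplit R) (unsplit (y |: R :\ a)).
  move=> gR aR; rewrite !inE => /andP[yR]; have [ya|ya /= yD0 gQ] := eqVneq y a.
    by rewrite ya aR in yR.
  rewrite /unsplit aR !inE eqxx eq_sym (negbTE ya) /=.
  have := connect_split_vertex (X := R :\ a) (y := y); rewrite setUCA setD1K //.
  by apply => //; rewrite ?inE ?negb_and ?yR ?orbT // subDset (good_sub gR).
move=> sPQ; have /and3P[gP gQ] := sPQ.
case/exists_inP => x xP /exists_inP[y yP /eqP QE].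
have [xa|xa] := eqVneq x a; first by rewrite QE; move: QE gQ xP; rewrite xa => -> *; apply: main.
have yE : y \in D' /\ y \notin P by move: yP; rewrite inE => /andP[].
have xD : x \in D' by apply: (subsetP (good_sub gP)).
have xy : x != y by apply: contraNneq yE.2 => <-.
have PE : P = x |: Q :\ y.
  apply/setP => z; rewrite QE !inE.
  have [->|zx] := eqVneq z x; first by rewrite xP.
  by have [->|//] := eqVneq z y; rewrite (negbTE yE.2).
(* If the merged edge enters [P], the exchange is read backwards. *)
have [ya|ya] := eqVneq y a.
  rewrite connect_swap_sym PE; move: PE gP; rewrite ya => PE gP.
  apply: main; rewrite -?PE //; first by rewrite QE ya setU11.
  by rewrite inE xD QE !inE eqxx (negbTE xy).
have xD0 : x \in D0 by move: xD; rewrite !inE (negbTE xa).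
have yD0 : y \in D0 by move: yE.1; rewrite !inE (negbTE ya).
have aPQ : (a \in Q) = (a \in P) by rewrite QE !inE ![a == _]eq_sym (negbTE xa) (negbTE ya).
have E1 : unsplit Q = y |: (unsplit P) :\ x.
  rewrite /unsplit aPQ QE; case: ifP => _; apply/setP => z; rewrite !inE.
    have [->|zb] := eqVneq z b; last by [].
    by rewrite !(neqD0 bK).
  have [->|zb] := eqVneq z c; last by [].
  by rewrite !(neqD0 cK').
rewrite E1; apply: swap1; rewrite -?E1 ?good_unsplit ?(good_sub gP) ?(good_sub gQ) //.
  by rewrite /unsplit; case: ifP => _; rewrite inE xP orbT.
have yD : y \in D by rewrite inE yD0 orbT.
rewrite inE yD andbT /unsplit; case: ifP => _; rewrite !inE (negbTE yE.2) orbF.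
  by rewrite (neqD0 bK).
by rewrite (neqD0 cK').
Qed.

(** Both bases meet the star, so [c] is opposite to [a] and [b]. *)
Lemma good_star3 P : good d D P -> (a \in P) = (b \in P) -> (c \in P) = (a \notin P).
Proof.
case/andP => bP bQ Eab; have K0 : K != set0 by apply/set0Pn; exists a.
have [x xK xP] := basis_meets_star tK tD0 bP K0.
have [y yK] := basis_meets_star tK tD0 bQ K0; rewrite inE => /andP[yP _].
move: xK yK xP yP; rewrite !inE.
by move=> /or3P[]/eqP-> /or3P[]/eqP->; rewrite -?Eab => -> // /negbTE->.
Qed.

(** The pairs separating [c] from [a] and [b] are exactly the images under [unsplit] of the pairs of
    the split code, whose connecting walks are lifted. *)
Lemma connect_star3 P Q :
  (forall P Q, good d' D' P -> good d' D' Q -> connect (swap d' D') P Q) ->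
  good d D P -> good d D Q -> (a \in P) = (b \in P) -> (a \in Q) = (b \in Q) ->
  connect (swap d D) P Q.
Proof.
move=> IH gP gQ eP eQ.
have split R : good d D R -> (a \in R) = (b \in R) ->
    exists2 R', good d' D' R' & R = unsplit R'.
  move=> gR eR; have cR := good_star3 gR eR.
  have RE : R = unsplit (R :\ b :\ c).
    apply/setP => e; rewrite /unsplit !inE !cN /=.
    case: ifPn => aR; rewrite !inE.
      have [->|eb] := eqVneq e b; first by rewrite -eR aR.
      by have [->|//] := eqVneq e c; rewrite cR aR.
    have [->|eb] := eqVneq e c; first by rewrite cR aR.
    by have [->|//] := eqVneq e b; rewrite -eR (negbTE aR).
  exists (R :\ b :\ c) => //; rewrite -good_unsplit -?RE //.
  apply/subsetP => e; rewrite !inE => /and3P[ec eb /(subsetP (good_sub gR))].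
  by rewrite !inE (negbTE ec) (negbTE eb) !orbF.
have [P' gP' ->] := split _ gP eP; have [Q' gQ' ->] := split _ gQ eQ.
by apply: connect_homo (IH _ _ gP' gQ'); apply: connect_unsplit.
Qed.

Lemma connect_star3_move P : good d D P -> (a \in P) = (b \in P) ->
  exists Q, [/\ good d D Q, connect (swap d D) P Q
    & (a \in Q) = (c \in Q) \/ (b \in Q) = (c \in Q)].
Proof.
have main R : good d D R -> a \in R -> b \in R -> exists Q, [/\ good d D Q,
    connect (swap d D) R Q & (a \in Q) = (c \in Q) \/ (b \in Q) = (c \in Q)].
  move=> gR aR bR; have cR : c \in R = false by rewrite good_star3 ?aR ?bR.
  have RE : R = a |: (b |: R :&: D0).
    apply/setP => e; rewrite !inE.
    have [->|ea] := eqVneq e a; first by rewrite aR.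
    have [->|eb] := eqVneq e b; first by rewrite bR.
    case eR: (e \in R) => //=; have := subsetP (good_sub gR) e eR; rewrite !inE.
    by rewrite (negbTE ea) (negbTE eb) /= => /orP[/eqP ec|->//]; rewrite ec cR in eR.
  have [|x xab [gx hx]] := @good_rotate (R :&: D0) (subsetIr _ _); first by rewrite -RE.
  exists (x |: (c |: R :&: D0)); split => //; first by rewrite {1}RE.
  by case/orP: xab => /eqP->; [left | right]; rewrite !inE !eqxx ?orbT.
move=> gP eP; case aP: (a \in P); first by apply: main; rewrite -?eP.
have sP := good_sub gP.
(* Here [a] and [b] lie in the second basis, which is rotated in place of the first. *)
have [|||Q [gQ hQ eQ]] := main (D :\: P); rewrite ?goodC //.
- by rewrite !inE aP eqxx.
- by rewrite !inE -eP aP eqxx orbT.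
exists (D :\: Q); rewrite goodC ?(good_sub gQ) //; split => //.
  by have := connect_swapC hQ; rewrite setDDr setDv set0U (setIidPr sP).
by rewrite !inE !eqxx !orbT; case: eQ => ->; [left | right].
Qed.

End Split.
End Additive.

(* [option bool] serves as an index set with three elements. *)
Lemma connect_three_classes (T : finType) (e : rel T) (g : pred T)
    (cl : option bool -> pred T) :
  connect_sym e -> (forall x, g x -> exists i, cl i x) ->
  (forall i x y, g x -> g y -> cl i x -> cl i y -> connect e x y) ->
  (forall i x, g x -> cl i x -> exists y j, [/\ g y, connect e x y, j != i & cl j y]) ->
  forall x y, g x -> g y -> connect e x y.
Proof.
move=> esym hcl hin hmove x y gx gy.
have [i ix] := hcl x gx; have [j jy] := hcl y gy.
have [ij|ij] := eqVneq i j; first by apply: (hin i) => //; rewrite ij.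
have [x' [k [gx' xx' ki kx']]] := hmove i x gx ix.
have [y' [l [gy' yy' lj ly']]] := hmove j y gy jy.
have [kj|kj] := eqVneq k j.
  by apply: connect_trans xx' (hin k _ _ _ _ _ _); rewrite // kj.
rewrite esym in yy'.
have [li|li] := eqVneq l i.
  by apply: connect_trans (hin l _ y' _ _ _ _) yy'; rewrite // li.
(* Both [k] and [l] differ from the distinct [i] and [j], so both are the third index. *)
have kl : k = l by move: i j k l ij ki lj kj li {ix jy kx' ly'} => [[]|] [[]|] [[]|] [[]|].
apply: connect_trans xx' (connect_trans (hin k _ y' _ _ _ _) yy') => //.
by rewrite kl.
Qed.

(** * Cuts of a graph *)

Section GraphCut.
Variables (V E : finType).
Implicit Types (ends : E -> V * V) (D F P Q : {set E}) (S : {set V}) (v : V).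

Definition cut ends S e := ((ends e).1 \in S) (+) ((ends e).2 \in S).

Lemma cutD ends S T : exists W, forall e, cut ends W e = cut ends S e (+) cut ends T e.
Proof.
exists [set x | (x \in S) (+) (x \in T)] => e.
by rewrite /cut !inE addbACA.
Qed.

(** Loops lie in no cut, so they are not counted. *)
Definition star ends D v := [set e in D | cut ends [set v] e].

Lemma cut1E ends v e :
  cut ends [set v] e = ((ends e).1 != (ends e).2) && (v \in [set (ends e).1; (ends e).2]).
Proof.
rewrite /cut !inE ![v == _]eq_sym.
have [->|h1] := eqVneq (ends e).1 v; first by rewrite eq_sym; case: eqVneq.
have [->|h2] := eqVneq (ends e).2 v; first by rewrite h1.
by rewrite andbF.
Qed.

(** Double counting: each edge is counted once per end, and loops not at all. *)
Lemma sum_star ends D : \sum_v #|star ends D v| <= 2 * #|D|.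
Proof.
have -> : \sum_v #|star ends D v| = \sum_v \sum_(e in D) cut ends [set v] e.
  apply: eq_bigr => v _; rewrite -sum1_card big_mkcond [RHS]big_mkcond.
  by apply: eq_bigr => e _; rewrite inE; case: (e \in D).
rewrite exchange_big mulnC -sum_nat_const; apply: leq_sum => e _.
apply: (@leq_trans #|[set (ends e).1; (ends e).2]|); last by rewrite cards2; case: (_ != _).
rewrite -sum1_card [leqRHS]big_mkcond; apply: leq_sum => v _.
by rewrite cut1E; case: (v \in _); rewrite ?andbF ?leq_b1.
Qed.

(** All subsets of [F] are traces of cuts. On [D] a cut depends only on the part of its vertex set
    inside the set [W] of non-isolated vertices, and complementing lets that part omit [v0]. So [F]
    has at most as many subsets as [W :\ v0]. *)
Lemma card_indep_lt ends D F v0 : F \subset D -> indep (cut ends) F -> star ends D v0 != set0 ->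
  #|F| < #|[set v | star ends D v != set0]|.
Proof.
move=> sF iF sv0; set W := [set v | _].
have v0W : v0 \in W by rewrite inE.
have cutW S e : e \in D -> cut ends (S :&: W) e = cut ends S e.
  move=> eD; have [h|h] := eqVneq (ends e).1 (ends e).2; first by rewrite /cut h !addbb.
  suff hW x : x \in [set (ends e).1; (ends e).2] -> x \in W.
    by rewrite /cut !in_setI !hW ?andbT // !inE eqxx ?orbT.
  by move=> hx; rewrite inE; apply/set0Pn; exists e; rewrite inE eD cut1E h.
have cutC S e : cut ends (~: S) e = cut ends S e.
  by rewrite /cut !inE addbN addNb negbK.
rewrite (cardsD1 v0) v0W add1n ltnS -(leq_exp2l _ _ (ltnSn 1)) -!card_powerset.
pose f S := [set e in F | cut ends S e].
apply: leq_trans (leq_imset_card f _); apply: subset_leq_card.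
apply/subsetP => G; rewrite inE => sG.
have [S hS] := indep_cut (cutD ends) set0 iF sG.
have GE S' : (forall e, e \in D -> cut ends S' e = cut ends S e) -> G = f (S' :&: W).
  move=> h; apply/setP => e; rewrite inE; case eF: (e \in F) => /=.
    by rewrite cutW ?h ?hS // (subsetP sF).
  by apply: contraFF eF; apply/subsetP.
have main S' : v0 \notin S' -> S' :&: W \in powerset (W :\ v0).
  by move=> h; rewrite inE subsetD1 subsetIr inE (negbTE h).
apply/imsetP; case vS: (v0 \in S).
  exists (~: S :&: W); last by apply: GE => e _; apply: cutC.
  by apply: main; rewrite inE vS.
by exists (S :&: W); [apply: main; rewrite vS | apply: GE].
Qed.

(** If every non-isolated vertex had degree at least four, [4 * #|W|] would be at most [2 * #|D|],
    while each of the two bases has fewer than [#|W|] edges. *)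
Lemma exists_star_le3 ends D P : good (cut ends) D P -> D != set0 ->
  exists v, 0 < #|star ends D v| <= 3.
Proof.
case/andP => /and3P[sP iP _] /and3P[sQ iQ _] /set0Pn[e eD].
set W := [set v | star ends D v != set0].
have [v0 v0W] : exists v, star ends D v != set0.
  (* An edge of a basis lies in some cut, so it is no loop and its ends are not isolated. *)
  have [S hS] : exists S, cut ends S e.
    case eP: (e \in P).
      by have [S hS] := indepP _ _ iP e eP; exists S; rewrite hS // eqxx.
    have eQ : e \in D :\: P by rewrite inE eP.
    by have [S hS] := indepP _ _ iQ e eQ; exists S; rewrite hS // eqxx.
  exists (ends e).1; apply/set0Pn; exists e; rewrite inE eD cut1E !inE eqxx andbT.
  by apply: contraTneq hS; rewrite /cut => ->; rewrite addbb.
have hP := card_indep_lt sP iP v0W; have hQ := card_indep_lt sQ iQ v0W.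
have /existsP[v] : [exists v, 0 < #|star ends D v| <= 3]; last by exists v.
apply: contraT; rewrite negb_exists => /forallP h.
have h4 : #|W| * 4 <= 2 * #|D|.
  apply: leq_trans (sum_star ends D); rewrite -sum_nat_const big_mkcond.
  apply: leq_sum => v _; rewrite inE -card_gt0; have := h v.
  by case: ifP => //= _; rewrite -ltnNge.
have DE : #|D| = #|P| + #|D :\: P| by rewrite -(cardsID P D) (setIidPr sP).
have : 2 * #|D| < #|W| * 4.
  rewrite DE (_ : 4 = 2 * 2) // mulnA [#|W| * 2]mulnC -mulnA ltn_pmul2l // muln2 -addnn.
  by rewrite -addSn leq_add // ltnW.
by rewrite ltnNge h4.
Qed.

(** In the sum over two star edges the term of [v] cancels, which leaves the cut value of an edge
    joining the two far ends. *)
Lemma cut_far ends S v e : cut ends [set v] e -> cut ends S e =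
  (v \in S) (+) ((if (ends e).1 == v then (ends e).2 else (ends e).1) \in S).
Proof.
rewrite cut1E !inE /cut => /andP[_]; rewrite ![v == _]eq_sym.
by have [->//|_ /= /eqP->] := eqVneq (ends e).1 v; rewrite addbC.
Qed.

Lemma connect_swap ends D P Q :
  good (cut ends) D P -> good (cut ends) D Q -> connect (swap (cut ends) D) P Q.
Proof.
(* The endpoint map is generalized, because splitting redirects an edge. *)
have [n] := ubnP #|D|; elim: n => // n IHn in ends D P Q *; rewrite ltnS => Dn gP gQ.
have [D0|D0] := eqVneq D set0.
  have := good_sub gP; have := good_sub gQ; rewrite D0 !subset0 => /eqP-> /eqP->.
  exact: connect0.
have [v] := exists_star_le3 gP D0 => {D0}.
set K := star ends D v => Kn; pose D0 := D :\: K.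
have sK : K \subset D by apply/subsetP => e; rewrite inE => /andP[].
have KD0 : [disjoint K & D0] by rewrite disjoint_sym disjoints_subset subsetDr.
have DE : D = K :|: D0 by rewrite -[LHS](setID D K) (setIidPr sK).
have tK e : e \in K -> cut ends [set v] e = true by rewrite inE => /andP[].
have tD0 e : e \in D0 -> cut ends [set v] e = false.
  by rewrite !inE => /andP[+ eD]; rewrite eD => /negbTE.
have cardD : #|D| = #|K| + #|D0| by rewrite DE cardsU disjoint_setI0 // cards0 subn0.
rewrite DE in gP gQ *.
have cK : star_const (cut ends) D0 K := good_star_const (cutD ends) tK tD0 gP Kn.
case/andP: Kn => /card_gt0P[a aK] K3.
have K0 : K != set0 by apply/set0Pn; exists a.
(* Degree one is impossible: two disjoint bases both meet the star. *)
have [K1|/set0Pn[b]] := eqVneq (K :\ a) set0.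
  have {}K1 : K = [set a] by rewrite -(setD1K aK) K1 setU0.
  have /andP[bP bQ] := gP.
  have [x] := basis_meets_star tK tD0 bP K0; rewrite {1}K1 inE => /eqP-> aP.
  have [y] := basis_meets_star tK tD0 bQ K0; rewrite {1}K1 inE => /eqP->.
  by rewrite inE aP.
rewrite in_setD1 => /andP[ba bK].
have ab : a != b by rewrite eq_sym.
have bKa : b \in K :\ a by rewrite in_setD1 ba.
have cardKab : #|K| = 2 + #|K :\ a :\ b|.
  by rewrite (cardsD1 a) aK (cardsD1 b (K :\ a)) bKa.
have [K2|/set0Pn[c]] := eqVneq (K :\ a :\ b) set0.
  have {}K2 : K = [set a; b] by rewrite -(setD1K aK) -(setD1K bKa) K2 setU0.
  rewrite K2 in KD0 tK gP gQ *.
  apply: (connect_star2 (cutD ends) ab KD0 tK tD0) => // P' Q'; apply: IHn.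
  by apply: leq_trans Dn; rewrite cardD cardKab !addSn ltnS leqW // leq_addl.
rewrite !in_setD1 => /and3P[cb ca cK'].
have {}K3 : K = a |: (b |: [set c]).
  apply/esym/eqP; rewrite eqEcard !subUset !sub1set aK bK cK' /=.
  by apply: leq_trans K3 _; rewrite !cardsU1 cards1 !inE negb_or ab eq_sym ca eq_sym cb.
(* Stated for any order of the three edges, so that each of them can be the separated one [z]. *)
have star3 x y z : x != y -> x != z -> y != z -> K = x |: (y |: [set z]) ->
  (forall P Q, good (cut ends) (K :|: D0) P -> good (cut ends) (K :|: D0) Q ->
     (x \in P) = (y \in P) -> (x \in Q) = (y \in Q) ->
     connect (swap (cut ends) (K :|: D0)) P Q) /\
  (forall P, good (cut ends) (K :|: D0) P -> (x \in P) = (y \in P) ->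
     exists Q, [/\ good (cut ends) (K :|: D0) Q, connect (swap (cut ends) (K :|: D0)) P Q
    & (x \in Q) = (z \in Q) \/ (y \in Q) = (z \in Q)]).
  move=> xy xz yz Kxyz; rewrite Kxyz in KD0 tK cK *.
  have xK : x \in x |: (y |: [set z]) by rewrite !inE eqxx.
  have yK : y \in x |: (y |: [set z]) by rewrite !inE eqxx orbT.
  split => [{gP gQ}P {}Q gP gQ eP eQ|{gP}P gP eP].
    pose far e := if (ends e).1 == v then (ends e).2 else (ends e).1.
    pose ends' e := if e == x then (far x, far y) else ends e.
    apply: (@connect_star3 _ _ _ (cutD ends) D0 x y z [set v] (cut ends')) => //.
    - move=> S e eD0; rewrite /cut /ends' (star_neq KD0 xK eD0) //.
    - move=> S; rewrite !(cut_far _ (tK _ _)) // addbACA addbb addFb.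
      by rewrite /cut /ends' eqxx.
    - move=> P' Q'; apply: IHn; apply: leq_trans Dn; rewrite cardD cardKab.
      rewrite cardsU1 !addSn ltnS; apply: leq_trans (leq_add (leq_b1 _) (leqnn _)) _.
      by rewrite add1n ltnS leq_addl.
  exact: (connect_star3_move (cutD ends) xy xz yz KD0 tK tD0 cK gP eP).
have ac : a != c by rewrite eq_sym.
have bc : b != c by rewrite eq_sym.
have [Cab Mab] := star3 a b c ab ac bc K3.
have [|Cac Mac] := star3 a c b ac ab cb; first by rewrite K3 [b |: _]setUC.
have [|Cbc Mbc] := star3 b c a bc ba ca; first by rewrite K3 setUC -setUA.
pose cl (i : option bool) (R : {set E}) := match i with
  | None => (a \in R) == (b \in R)
  | Some true => (a \in R) == (c \in R)
  | Some false => (b \in R) == (c \in R)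
  end.
apply: (@connect_three_classes _ _ (good (cut ends) (K :|: D0)) cl) => //.
- exact: connect_swap_sym.
- move=> R _; case eab: ((a \in R) == (b \in R)); first by exists None.
  case eac: ((a \in R) == (c \in R)); first by exists (Some true).
  exists (Some false) => /=; move: eab eac.
  by case: (a \in R); case: (b \in R); case: (c \in R).
- by case=> [[]|] X Y gX gY /eqP eX /eqP eY; [apply: Cac | apply: Cbc | apply: Cab].
- case=> [[]|] X gX /eqP eX.
  + have [Y [gY hY [eY|eY]]] := Mac X gX eX; exists Y; [exists None | exists (Some false)];
      by split; rewrite //= eY.
  + have [Y [gY hY [eY|eY]]] := Mbc X gX eX; exists Y; [exists None | exists (Some true)];
      by split; rewrite //= eY.
  + have [Y [gY hY [eY|eY]]] := Mab X gX eX; exists Y; [exists (Some true) | exists (Some false)];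
      by split; rewrite //= eY.
Qed.

End GraphCut.

(** * Bases of the cycle matroid *)

Section CycleMatroid.
Variables (V E : finType) (ends : E -> V * V).
Implicit Types (B F : {set E}) (S : {set V}).

Lemma joins_cut S e u v : joins ends e u v -> cut ends S e = (u \in S) (+) (v \in S).
Proof. by rewrite /cut => /orP[]/eqP->; rewrite // addbC. Qed.

Lemma joins_ends e : joins ends e (ends e).1 (ends e).2.
Proof. by rewrite /joins -surjective_pairing eqxx. Qed.

Lemma joinsC e u v : joins ends e u v = joins ends e v u.
Proof. exact: orbC. Qed.

(** The sum telescopes along the walk; for a closed walk it vanishes. *)
Lemma walk_cut S es x s y : size es = (size s).+1 ->
  all (fun t => joins ends t.1 t.2.1 t.2.2) (zip es (zip (x :: s) (rcons s y))) ->
  \big[addb/false]_(e <- es) cut ends S e = (x \in S) (+) (y \in S).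
Proof.
elim: es x s => // e es IHes x [|w s] /= [sz] /andP[/(joins_cut S) he hs].
  by rewrite big_cons he (size0nil sz) big_nil addbF.
by rewrite big_cons he (IHes w s) // addbA addbK.
Qed.

(** A cycle meets every cut in an even number of edges, so no cut meets it in a single edge. *)
Lemma indep_acyclic F : indep (cut ends) F -> acyclic ends F.
Proof.
move=> /indepP iF C [es [vs [[es0 sz ues uvs] [CE]]]] + sCF.
case: es vs es0 sz ues uvs CE => // e es [//|x s] _ sz /= /andP[ees _] _ CE.
rewrite rot1_cons => hs.
have sub f : f \in e :: es -> f \in F by move=> fes; apply: (subsetP sCF); rewrite CE inE.
have [S hS] := iF e (sub e (mem_head _ _)).
have := walk_cut S (es := e :: es) sz hs; rewrite addbb big_cons hS ?sub ?mem_head // eqxx.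
rewrite big_seq big1 // => f fes; rewrite hS ?sub ?inE ?fes ?orbT //.
by apply: contraNF ees => /eqP <-.
Qed.

(** The clause on ends makes the edges distinct: the first edge has the end [x], which no later edge
    reaches. The last clause appends a closing edge in the format of [is_cycle]. *)
Lemma path_edges F x s :
  path [rel u v | [exists f in F, joins ends f u v]] x s -> uniq (x :: s) ->
  exists es, [/\ size es = size s, uniq es, {subset es <= F},
    forall f, f \in es -> ((ends f).1 \in x :: s) && ((ends f).2 \in x :: s)
  & forall e z, joins ends e (last x s) z ->
      all (fun t => joins ends t.1 t.2.1 t.2.2) (zip (rcons es e) (zip (x :: s) (rcons s z)))].
Proof.
elim: s x => [|w s IHs] x /=.
  by move=> _ _; exists [::]; split => // e z /= ->.
case/andP => /exists_inP[f fF fxw] /IHs{}IHs /andP[xs us].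
have [es [sz ues sF hin hall]] := IHs us.
exists (f :: es); split => //=.
- by rewrite sz.
- rewrite ues andbT; apply: contra xs => /hin.
  by case/orP: fxw => /eqP-> /andP[].
- by move=> g; rewrite inE => /orP[/eqP->|/sF].
- move=> g; rewrite inE => /orP[/eqP->|/hin].
    by case/orP: fxw => /eqP->; rewrite !inE !eqxx !orbT.
  by rewrite ![_ \in x :: _]inE => /andP[-> ->]; rewrite !orbT.
- by move=> e z /hall; rewrite fxw.
Qed.

(** If the ends of [e] are linked within [F :\ e], a simple path between them closes to a cycle;
    otherwise the component of one end bounds a cut whose only edge in [F] is [e]. *)
Lemma acyclic_indep F : acyclic ends F -> indep (cut ends) F.
Proof.
move=> aF; apply/indepP => e eF.
set r := [rel u v | [exists f in F :\ e, joins ends f u v]].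
have rsym : symmetric r.
  by move=> u v; apply: eq_existsb => f; rewrite joinsC.
have csym := sym_connect_sym rsym.
case: (boolP (connect r (ends e).1 (ends e).2)) => [/connectP[s0]|nc].
  move=> /shortenP[s ps us _] lst.
  have [es [sz ues sF _ hall]] := path_edges ps us.
  case: (aF [set f in rcons es e]); last first.
    apply/subsetP => f; rewrite inE mem_rcons inE => /orP[/eqP->//|/sF].
    by rewrite !inE => /andP[].
  exists (rcons es e), ((ends e).1 :: s); split.
    rewrite size_rcons sz; split => //; rewrite rcons_uniq ues andbT.
    by apply/negP => /sF; rewrite !inE eqxx.
  split => //; rewrite rot1_cons; apply: hall.
  by rewrite -lst joinsC joins_ends.
exists [set z | connect r (ends e).1 z] => f fF; rewrite /cut !inE.
have [->|fe] := eqVneq f e; first by rewrite connect0 (negbTE nc).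
have rf : r (ends f).1 (ends f).2.
  by apply/exists_inP; exists f; rewrite ?inE ?fe // joins_ends.
by rewrite (same_connect_r csym (connect1 rf)) addbb.
Qed.

(** A cut avoiding [B] but containing [e] would make [e |: B] independent, against maximality.
    Conversely, a cut isolating [e] in [e |: B] avoids [B], so spanning fails. *)
Lemma is_basisP B : is_basis ends B <-> basis (cut ends) setT B.
Proof.
split=> [[aB mB]|/basisP[_ iB spB]].
  have /indepP iB := acyclic_indep aB.
  apply/basisP; split => // S hS e _; apply/negbTE/negP => Se.
  have eB : e \notin B by apply/negP => /hS; rewrite Se.
  apply: (mB e eB); apply: indep_acyclic; apply/indepP => f.
  have neq g : g \in B -> (g == e = false) * (e == g = false).
    move=> gB; suff h : g == e = false by split; rewrite // eq_sym.
    by apply: contraNF eB => /eqP<-.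
  rewrite !inE => /orP[/eqP->|fB].
    by exists S => g; rewrite !inE => /orP[/eqP->|gB]; [rewrite eqxx | rewrite hS // (neq g)].
  have [T hT] := iB f fB.
  (* Adding [S] removes [e] from the cut and changes nothing on [B]. *)
  case Te: (cut ends T e).
    have [W hW] := cutD ends T S; exists W => g.
    rewrite !inE => /orP[/eqP->|gB]; rewrite hW; first by rewrite Te Se (neq f).
    by rewrite hT // hS // addbF.
  by exists T => g; rewrite !inE => /orP[/eqP->|/hT//]; rewrite Te (neq f).
split; first by apply: indep_acyclic; apply/indepP.
move=> e eB /acyclic_indep/indepP /(_ e (setU11 _ _))[S hS].
suff : cut ends S e = false by rewrite hS ?setU11 // eqxx.
apply: spB => // f fB; rewrite hS ?setU1r //.
by apply: contraNF eB => /eqP<-.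
Qed.

(** Vertex sets are counted: [2 ^ #|V|] is [2 ^ #|B|] times two to the number of components. *)
Lemma card_basis B : basis (cut ends) setT B -> #|B| = cycle_rank ends.
Proof.
case/basisP => _ /indepP iB spB.
have asym : symmetric (adjG ends).
  by move=> u v; apply: eq_existsb => f; rewrite joinsC.
have csym := sym_connect_sym asym.
pose Rt := [set x in roots (adjG ends)].
have rootRt x : root (adjG ends) x \in Rt by rewrite inE; apply: roots_root.
have rootE x : x \in Rt -> root (adjG ends) x = x by rewrite inE => /eqP.
have root_ends e : root (adjG ends) (ends e).1 = root (adjG ends) (ends e).2.
  by apply/(rootP csym)/connect1/existsP; exists e; apply: joins_ends.
(* A vertex set is determined by its cut within [B] together with its trace on a
   transversal of the components, and both may be prescribed. *)
pose h S := ([set e in B | cut ends S e], S :&: Rt).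
have hinj : injective h.
  move=> S T [/setP hB /setP hR]; apply/setP => x.
  pose W := [set x | (x \in S) (+) (x \in T)].
  have WE e : cut ends W e = cut ends S e (+) cut ends T e.
    by rewrite /cut !inE addbACA.
  (* The cut of the symmetric difference avoids [B], hence every edge, so [W] is a union of
     components; it contains no root, so it is empty. *)
  have W0 e : cut ends W e = false.
    apply: (spB W _ e) => // f fB; rewrite WE; have := hB f; rewrite !inE fB /= => ->.
    by rewrite addbb.
  have clW : closed (adjG ends) (mem W).
    move=> u v /existsP[e /(joins_cut W)]; rewrite W0 => /esym.
    by rewrite !inE; do 4![case: (_ \in _)].
  have : x \in W = false.
    rewrite (closed_connect clW (connect_root _ x)) inE.
    by have := hR (root (adjG ends) x); rewrite !in_setI rootRt !andbT => ->; rewrite addbb.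
  by rewrite inE; case: (x \in S); case: (x \in T).
have him : h @: setT = setX (powerset B) (powerset Rt).
  apply/setP => -[G R]; rewrite in_setX !inE; apply/imsetP/andP.
    case=> S _ [-> ->]; rewrite subsetIr; split => //.
    by apply/subsetP => e; rewrite inE => /andP[].
  case=> sG sR; have [S hS] := indep_cut (cutD ends) set0 iB sG.
  (* Components whose root is on the wrong side are flipped as a whole, which changes no cut
     value. *)
  pose T := [set x | (x \in S) (+) ((root (adjG ends) x \in S) (+) (root (adjG ends) x \in R))].
  exists T => //; congr (_, _); apply/setP => x.
    rewrite inE /cut !inE root_ends addbACA addbb addbF -/(cut ends S x).
    case xB: (x \in B) => /=; first by rewrite hS.
    by apply: contraFF xB; apply/subsetP.
  rewrite in_setI [x \in T]inE; case xR: (x \in Rt).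
    by rewrite rootE // addbA addbb andbT.
  by rewrite andbF; apply: contraFF xR; apply/subsetP.
have := card_imset setT hinj; rewrite him cardsX !card_powerset -powersetT card_powerset.
rewrite cardsT -expnD => /eqP; rewrite eqn_exp2l // => /eqP VE.
rewrite /cycle_rank -VE; have -> : n_comp (adjG ends) (mem predT) = #|Rt|.
  by rewrite cardsE; apply: eq_card => x; rewrite !inE andbT.
by rewrite addnK.
Qed.

End CycleMatroid.

Theorem theorem4p1 (V E : finType) (ends : E -> V * V) :
  #|E| = 2 * cycle_rank ends ->
  exchange_graph_connected ends.
Proof.
move=> cardE p q.
pose f (P : {set E}) := (P, ~: P).
have xvertexE R : xvertex ends R -> good (cut ends) setT R.1 /\ R = f R.1.
  case: R => R1 R2 [/= /is_basisP b1 /is_basisP b2 dis].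
  (* Two disjoint bases have [2r] edges together, which is all of them. *)
  have R2E : R2 = ~: R1.
    apply/eqP; rewrite eqEcard -disjoints_subset disjoint_sym dis /=.
    by rewrite cardsCs setCK cardE (card_basis b1) (card_basis b2) mul2n -addnn addnK.
  by rewrite /good setTD b1 -R2E b2 /f R2E.
have good_xvertex P : good (cut ends) setT P -> xvertex ends (f P).
  case/andP => b1; rewrite setTD => b2; split; try exact/is_basisP.
  by rewrite disjoints_subset setCK.
case/xvertexE => gp pE /xvertexE [gq qE].
have /connectP[s ps lst] := connect_swap gp gq.
exists (map f s); split; first by rewrite {1}pE last_map -lst -qE.
move=> i; rewrite size_map => si.
have -> : p :: map f s = map f (p.1 :: s) by rewrite /= -pE.
have si' : i < size (p.1 :: s) := leqW si.
rewrite !(nth_map p.1) //; have := pathP p.1 ps i si.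
move: (nth _ _ i) (nth _ s i) => P Q /and3P[gP gQ /exists_inP[x xP /exists_inP[y]]].
rewrite inE => /andP[yP _] /eqP QE; split; try exact: good_xvertex.
(* The exchange keeps all of [P] but [x], and [P] has [cycle_rank] edges. *)
have /andP[bP _] := gP; rewrite -(card_basis bP) /= QE [RHS](cardsD1 x) xP add1n.
congr (_.+1); apply: eq_card => z; rewrite !inE.
have [->|zx] := eqVneq z x; first by rewrite xP orbF andbT /=; apply: contraNF yP => /eqP<-.
by have [->|] := eqVneq z y; rewrite ?(negbTE yP) //= andbb.
Qed.
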